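(* Let $\mathscr{A}$ be a category with finite limits and $\mathscr{P}$ a projective class in $\mathscr{A}$. Any $\mathscr{P}$-projective (precubical) resolution $P\xrightarrow{\partial}A$ of an object $A\in\mathscr{A}$ is an augmented pseudocubical object with pseudoconnections (i.e., $P$ admits pseudodegeneracy morphisms and pseudoconnections making it a pseudocubical object with pseudoconnections).
   Context: A precubical object $X$ in $\mathscr{A}$ is a family of objects $(X_n)_{n\ge 0}$ with face morphisms $\partial_i^0,\partial_i^1: X_n\to X_{n-1}$ ($1\le i\le n$) satisfying $\partial_i^\alpha\partial_j^\varepsilon=\partial_{j-1}^\varepsilon\partial_i^\alpha$ for $i<j$, $\alpha,\varepsilon\in\{0,1\}$. An augmented precubical object $X\xrightarrow{\partial}A$ is a precubical object $X$ with an object $A$ and a morphism $\partial: X_0\to A$ such that $\partial\partial_1^0=\partial\partial_1^1$. A pseudocubical object is a precubical object together with pseudodegeneracy morphisms $s_i: X_{n-1}\to X_n$ ($1\le i\le n$) satisfying, for $\alpha\in\{0,1\}$: $\partial_i^\alpha s_j=s_{j-1}\partial_i^\alpha$ if $i<j$; $=\mathrm{id}$ if $i=j$; $=s_j\partial_{i-1}^\alpha$ if $i>j$. It has pseudoconnections if there are given morphisms $\Gamma_i: X_n\to X_{n+1}$ ($1\le i\le n$) satisfying: $\partial_i^\alpha\Gamma_j=\Gamma_{j-1}\partial_i^\alpha$ if $i<j$, $\alpha\in\{0,1\}$; $\partial_i^0\Gamma_j=\mathrm{id}$ if $i=j,j+1$; $\partial_i^1\Gamma_j=s_j\partial_j^1$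 if $i=j,j+1$; $\partial_i^\alpha\Gamma_j=\Gamma_j\partial_{i-1}^\alpha$ if $i>j+1$, $\alpha\in\{0,1\}$. Given a class $\mathscr{P}$ of objects of $\mathscr{A}$, a morphism $f: B\to B'$ is $\mathscr{P}$-epimorphic if $\mathrm{Hom}_{\mathscr{A}}(Q,f)$ is surjective for all $Q\in\mathscr{P}$. $\mathscr{P}$ is a projective class if for each object $B$ there is a $\mathscr{P}$-epimorphic $e: Q\to B$ with $Q\in\mathscr{P}$. A cubical kernel of a sequence of morphisms $f_1^0,\dots,f_n^0,f_1^1,\dots,f_n^1: B\to C$ ($n\ge1$) is a sequence $k_1^0,\dots,k_{n+1}^0,k_1^1,\dots,k_{n+1}^1: K\to B$ with $f_i^\omega k_j^\alpha=f_{j-1}^\alpha k_i^\omega$ for $1\le i<j\le n+1$, $\omega,\alpha\in\{0,1\}$, which is universal: for any sequence $h_1^0,\dots,h_{n+1}^0,h_1^1,\dots,h_{n+1}^1: D\to B$ satisfying the same identities there is a unique $h: D\to K$ with $k_i^\omega h=h_i^\omega$ for all $i,\omega$. For an augmented precubical object $X\xrightarrow{\partial}A$, let $k_1^0,k_1^1: K_1\to X_0$ be the kernel pair of $\partial: X_0\to A$ and, for $n\ge2$, let $k_1^0,\dots,k_n^0,k_1^1,\dots,k_n^1: K_n\to X_{n-1}$ be a cubical kernel of $(\partial_1^0,\dots,\partial_{n-1}^0,\partial_1^1,\dots,\partial_{n-1}^1)$, the faces $X_{n-1}\to X_{n-2}$. Let $e_n: X_n\to K_n$ ($n\ge1$)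 be the unique morphism with $k_i^\varepsilon e_n=\partial_i^\varepsilon$. Then $X\xrightarrow{\partial}A$ is a $\mathscr{P}$-projective resolution of $A$ if every $X_n\in\mathscr{P}$ ($n\ge0$) and $\partial$ and all $e_n$ ($n\ge1$) are $\mathscr{P}$-epimorphic. *)

(* Defs.v *)
From mathcomp Require Import all_boot.
Set Implicit Arguments.
Unset Strict Implicit.
Unset Printing Implicit Defensive.

Declare Scope cat_scope.
Delimit Scope cat_scope with cat.
Reserved Notation "g ∘ f" (at level 40, left associativity).

(** ** Categories and finite limits *)

Record category := Category {
  obj :> Type;
  hom : obj -> obj -> Type;
  idm : forall a : obj, hom a a;
  compose : forall a b c : obj, hom b c -> hom a b -> hom a c;
  compose_idl : forall (a b : obj) (f : hom a b), compose (idm b) f = f;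
  compose_idr : forall (a b : obj) (f : hom a b), compose f (idm a) = f;
  composeA : forall (a b c d : obj) (h : hom c d) (g : hom b c) (f : hom a b),
    compose h (compose g f) = compose (compose h g) f
}.
Arguments hom {c} a b : rename.
Arguments idm {c} a : rename.
Arguments compose {c a b c0} g f : rename.

Notation "g ∘ f" := (compose g f) : cat_scope.
Local Open Scope cat_scope.

Record functor (J C : category) := Functor {
  fobj :> J -> C;
  fmap : forall a b : J, hom a b -> hom (fobj a) (fobj b);
  fmap_id : forall a : J, fmap (idm a) = idm (fobj a);
  fmap_comp : forall (a b c : J) (g : hom b c) (f : hom a b),
    fmap (g ∘ f) = fmap g ∘ fmap f
}.

Definition is_cone (J C : category) (F : functor J C) (L : C)
    (p : forall j : J, hom L (F j)) : Prop :=
  forall (i j : J) (u : hom i j), fmap F u ∘ p i = p j.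

Definition is_limit (J C : category) (F : functor J C) (L : C)
    (p : forall j : J, hom L (F j)) : Prop :=
  is_cone p /\
  forall (D : C) (q : forall j : J, hom D (F j)), is_cone q ->
    exists! h : hom D L, forall j : J, p j ∘ h = q j.

Definition finite_type (T : Type) : Prop :=
  exists (n : nat) (f : 'I_n -> T), bijective f.

Definition finite_category (J : category) : Prop :=
  finite_type J /\ forall a b : J, finite_type (hom a b).

Definition has_finite_limits (C : category) : Prop :=
  forall (J : category) (F : functor J C), finite_category J ->
    exists (L : C) (p : forall j : J, hom L (F j)), is_limit p.

(** ** Projective classes *)

Definition epimorphic_for (C : category) (P : C -> Prop) (B B' : C)
    (f : hom B B') : Prop :=
  forall Q : C, P Q -> forall g : hom Q B', exists h : hom Q B, f ∘ h = g.

Definition projective_class (C : category) (P : C -> Prop) : Prop :=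
  forall B : C, exists (Q : C) (e : hom Q B), P Q /\ epimorphic_for P e.

(** ** Precubical objects

    Superscripts 0 and 1 are [false] and [true].  Lower indices are natural
    numbers starting at 1.  A family indexed by 1 <= i <= m is represented by
    a function on all of [nat], and every axiom below constrains it only at
    indices within the range, so its other values are irrelevant.  (They
    always exist, as every family used here has m >= 1.) *)

(** [face X n i a] is the face of index (i, a) from X_(n+1) to X_n, for
    1 <= i <= n + 1. *)
Record precubical (C : category) := Precubical {
  cells :> nat -> C;
  face : forall n : nat, nat -> bool -> hom (cells n.+1) (cells n);
  face_face : forall (n i j : nat) (a e : bool), 1 <= i -> i < j -> j <= n.+2 ->
    face n i a ∘ face n.+1 j e = face n j.-1 e ∘ face n.+1 i a
}.
Arguments face {C} X n i a : rename.

Record augmented_precubical (C : category) (A : C) := AugmentedPrecubical {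
  precub :> precubical C;
  aug : hom (precub 0) A;
  aug_face : aug ∘ face precub 0 1 false = aug ∘ face precub 0 1 true
}.
Arguments aug {C A} X : rename.

(** ** Pseudodegeneracies and pseudoconnections *)

(** [s n j] is s_j from X_n to X_(n+1), for 1 <= j <= n + 1. *)
Record pseudodegeneracies (C : category) (X : precubical C)
    (s : forall n : nat, nat -> hom (X n) (X n.+1)) : Prop := {
  face_degen_lt : forall (n i j : nat) (a : bool),
    1 <= i -> i < j -> j <= n.+2 ->
    face X n.+1 i a ∘ s n.+1 j = s n j.-1 ∘ face X n i a;
  face_degen_eq : forall (n j : nat) (a : bool),
    1 <= j -> j <= n.+1 ->
    face X n j a ∘ s n j = idm (X n);
  face_degen_gt : forall (n i j : nat) (a : bool),
    1 <= j -> j < i -> i <= n.+2 ->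
    face X n.+1 i a ∘ s n.+1 j = s n j ∘ face X n i.-1 a
}.

(** There is no connection on X_0: [g n j] is Gamma_j from X_(n+1) to X_(n+2),
    for 1 <= j <= n + 1. *)
Record pseudoconnections (C : category) (X : precubical C)
    (s : forall n : nat, nat -> hom (X n) (X n.+1))
    (g : forall n : nat, nat -> hom (X n.+1) (X n.+2)) : Prop := {
  face_conn_lt : forall (n i j : nat) (a : bool),
    1 <= i -> i < j -> j <= n.+2 ->
    face X n.+2 i a ∘ g n.+1 j = g n j.-1 ∘ face X n.+1 i a;
  face0_conn : forall n i j : nat,
    1 <= j -> j <= n.+1 -> i = j \/ i = j.+1 ->
    face X n.+1 i false ∘ g n j = idm (X n.+1);
  face1_conn : forall n i j : nat,
    1 <= j -> j <= n.+1 -> i = j \/ i = j.+1 ->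
    face X n.+1 i true ∘ g n j = s n j ∘ face X n j true;
  face_conn_gt : forall (n i j : nat) (a : bool),
    1 <= j -> j.+1 < i -> i <= n.+3 ->
    face X n.+2 i a ∘ g n.+1 j = g n j ∘ face X n.+1 i.-1 a
}.

(** ** Cubical kernels and resolutions *)

Definition is_kernel_pair (C : category) (B A : C) (f : hom B A)
    (K : C) (k0 k1 : hom K B) : Prop :=
  f ∘ k0 = f ∘ k1 /\
  forall (D : C) (h0 h1 : hom D B), f ∘ h0 = f ∘ h1 ->
    exists! h : hom D K, k0 ∘ h = h0 /\ k1 ∘ h = h1.

(** [f] is indexed by 1 <= i <= n and [k] by 1 <= i <= n + 1. *)
Definition cubical_identities (C : category) (n : nat) (B B' : C)
    (f : nat -> bool -> hom B B') (K : C) (k : nat -> bool -> hom K B) : Prop :=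
  forall (i j : nat) (w a : bool), 1 <= i -> i < j -> j <= n.+1 ->
    f i w ∘ k j a = f j.-1 a ∘ k i w.

Definition is_cubical_kernel (C : category) (n : nat) (B B' : C)
    (f : nat -> bool -> hom B B') (K : C) (k : nat -> bool -> hom K B) : Prop :=
  cubical_identities n f k /\
  forall (D : C) (h : nat -> bool -> hom D B), cubical_identities n f h ->
    exists! u : hom D K,
      forall (i : nat) (w : bool), 1 <= i -> i <= n.+1 -> k i w ∘ u = h i w.

(** [k] exhibits [K] as the object K_(n+1) over X_n: the kernel pair of the
    augmentation if n = 0, a cubical kernel of the n pairs of faces from X_n
    to X_(n-1) otherwise. *)
Definition is_matching_kernel (C : category) (A : C)
    (X : augmented_precubical A) (n : nat) (K : C) :
    (nat -> bool -> hom K (X n)) -> Prop :=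
  match n return (nat -> bool -> hom K (X n)) -> Prop with
  | 0 => fun k => is_kernel_pair (aug X) (k 1 false) (k 1 true)
  | m.+1 => fun k => is_cubical_kernel m.+1 (face X m) k
  end.
Arguments is_matching_kernel {C A} X n {K} k.

(** By universality, the map [e] is determined by the choice of (K, k), and
    (K, k) is unique up to a unique isomorphism, so the existential
    quantifiers do not depend on any choice. *)
Definition projective_resolution (C : category) (P : C -> Prop) (A : C)
    (X : augmented_precubical A) : Prop :=
  [/\ forall n : nat, P (X n),
      epimorphic_for P (aug X) &
      forall n : nat,
        exists (K : C) (k : nat -> bool -> hom K (X n)) (e : hom (X n.+1) K),
          [/\ is_matching_kernel X n k,
              forall (i : nat) (a : bool), 1 <= i -> i <= n.+1 ->
                k i a ∘ e = face X n i a &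
              epimorphic_for P e]].

(* Main.v *)
Require Import Defs.
From mathcomp Require Import all_boot.
From mathcomp Require Import zify.
From Stdlib Require Import IndefiniteDescription.

(** If [Q] is in [P], a family of maps from [Q] to [X_n] satisfying the
    identities between the faces of an (n+1)-cube factors through [K_(n+1)],
    and, [e_(n+1)] being epimorphic for [P], comes from a map from [Q] to
    [X_(n+1)] with the prescribed faces.  As every [X_n] is in [P], each
    pseudodegeneracy and each pseudoconnection is obtained in this way from
    those one dimension lower, because the faces required of it satisfy the
    identities. *)

Set Implicit Arguments.
Unset Strict Implicit.
Unset Printing Implicit Defensive.
Local Open Scope cat_scope.

(** * Choice principles *)

(** Each stage is built from the maps actually chosen one dimension lower, so plain choice does not
    suffice. The recursion runs over elements paired with a proof of the invariant [I]. *)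
Lemma dependent_choice (T : nat -> Type) (I : forall n, T n -> Prop)
    (R : forall n, T n -> T n.+1 -> Prop) :
  (exists t, I 0 t) ->
  (forall n t, I n t -> exists t', I n.+1 t' /\ R n t t') ->
  exists t : forall n, T n, forall n, I n (t n) /\ R n (t n) (t n.+1).
Proof.
move=> /constructive_indefinite_description base step.
pose next n (x : {t | I n t}) :=
  constructive_indefinite_description _ (step n _ (svalP x)).
pose t := nat_rect (fun n => {t | I n t}) base
  (fun n x => exist _ (sval (next n x)) (proj1 (svalP (next n x)))).
exists (fun n => sval (t n)) => n; split; first exact: svalP.
exact: (proj2 (svalP (next n (t n)))).
Qed.

(** Families are total functions on [nat]. The range contains 1, and a witness at that index serves
    as default value outside it. *)
Lemma choice_on_range (T : Type) (m : nat) (R : nat -> T -> Prop) :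
  (forall j, 1 <= j <= m.+1 -> exists x, R j x) ->
  exists f : nat -> T, forall j, 1 <= j <= m.+1 -> R j (f j).
Proof.
move=> exR; apply: (functional_choice (fun j x => 1 <= j <= m.+1 -> R j x)).
move=> j; case: (boolP (1 <= j <= m.+1)) => [/exR [x Rx]|_]; first by exists x.
by have [x _] := exR 1 isT; exists x.
Qed.

(** * Filling boxes in a resolution *)

(** This form isolates what the inductive steps need, free of [P] and of the augmentation. Targets
    start at [X 2], since [X 1] is governed by a kernel pair instead of a cubical kernel. *)
Definition fills_boxes (C : category) (X : precubical C) : Prop :=
  forall (m n : nat) (h : nat -> bool -> hom (X m) (X n.+1)),
  cubical_identities n.+1 (face X n) h ->
  exists u : hom (X m) (X n.+2),
    forall i a, 1 <= i <= n.+2 -> face X n.+1 i a ∘ u = h i a.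

Lemma resolution_fills_boxes (C : category) (P : C -> Prop) (A : C)
    (X : augmented_precubical A) :
  projective_resolution P X -> fills_boxes X.
Proof.
case=> PX _ epi m n h hP; have [K [k [e [[_ univ] ke epi_e]]]] := epi n.+1.
have [v [kv _]] := univ _ _ hP; have [u eu] := epi_e _ (PX m) v.
by exists u => i a /andP[i1 iN]; rewrite -ke // -composeA eu kv.
Qed.

(** The pair of identities of [X 0] trivially agrees after the augmentation, so it factors through
    the kernel pair, and the factorization lifts to [X 1]. *)
Lemma resolution_degen0 (C : category) (P : C -> Prop) (A : C)
    (X : augmented_precubical A) :
  projective_resolution P X ->
  exists u : hom (X 0) (X 1), forall a, face X 0 1 a ∘ u = idm (X 0).
Proof.
case=> PX _ epi; have [K [k [e [[_ univ] ke epi_e]]]] := epi 0.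
have [v [[kv0 kv1] _]] := univ _ (idm (X 0)) _ erefl.
have [u eu] := epi_e _ (PX 0) v.
by exists u => -[]; rewrite -ke // -composeA eu.
Qed.

(** * Pseudodegeneracies *)

(** The faces required of the map [s_j] one dimension above [s]. *)
Definition degen_faces (C : category) (X : precubical C) (n : nat)
    (s : nat -> hom (X n) (X n.+1)) (j i : nat) (a : bool) :
    hom (X n.+1) (X n.+1) :=
  if i < j then s j.-1 ∘ face X n i a
  else if i == j then idm (X n.+1)
  else s j ∘ face X n i.-1 a.

Lemma degen_faces_lt (C : category) (X : precubical C) n
    (s : nat -> hom (X n) (X n.+1)) j i a :
  i < j -> degen_faces s j i a = s j.-1 ∘ face X n i a.
Proof. by rewrite /degen_faces => ->. Qed.

Lemma degen_faces_eq (C : category) (X : precubical C) n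
    (s : nat -> hom (X n) (X n.+1)) j a :
  degen_faces s j j a = idm (X n.+1).
Proof. by rewrite /degen_faces ltnn eqxx. Qed.

Lemma degen_faces_gt (C : category) (X : precubical C) n
    (s : nat -> hom (X n) (X n.+1)) j i a :
  j < i -> degen_faces s j i a = s j ∘ face X n i.-1 a.
Proof. by rewrite /degen_faces => ji; rewrite ltnNge ltnW //= gtn_eqF. Qed.

(** The identities that mention no pseudodegeneracy of lower dimension, hence meaningful already on
    [X 0]. *)
Definition degen_section (C : category) (X : precubical C) (n : nat)
    (s : nat -> hom (X n) (X n.+1)) : Prop :=
  forall j a, 1 <= j <= n.+1 -> face X n j a ∘ s j = idm (X n).

Definition degen_step (C : category) (X : precubical C) (n : nat)
    (s : nat -> hom (X n) (X n.+1))
    (s' : nat -> hom (X n.+1) (X n.+2)) : Prop :=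
  forall i j a, 1 <= i <= n.+2 -> 1 <= j <= n.+2 ->
  face X n.+1 i a ∘ s' j = degen_faces s j i a.

(** These instances of the identities do not involve the pseudodegeneracies one
    dimension below [s], so they also start the induction. *)
Lemma degen_faces_cubical_mid (C : category) (X : precubical C) n
    (s : nat -> hom (X n) (X n.+1)) j i k w a :
  degen_section s -> 1 <= j <= n.+2 -> 1 <= i -> i < k -> k <= n.+2 ->
  i = j \/ k = j ->
  face X n i w ∘ degen_faces s j k a = face X n k.-1 a ∘ degen_faces s j i w.
Proof.
move=> sec jN i1 ik kN [?|?]; subst.
- rewrite degen_faces_eq degen_faces_gt // composeA sec; last lia.
  by rewrite compose_idl compose_idr.
- rewrite degen_faces_eq degen_faces_lt // composeA sec; last lia.
  by rewrite compose_idl compose_idr.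
Qed.

Lemma degen_faces_cubical0 (C : category) (X : precubical C)
    (s : nat -> hom (X 0) (X 1)) j :
  degen_section s -> 1 <= j <= 2 ->
  cubical_identities 1 (face X 0) (degen_faces s j).
Proof.
move=> sec jN i k w a i1 ik kN.
by apply: degen_faces_cubical_mid => //; lia.
Qed.

Lemma degen_step_section (C : category) (X : precubical C) n
    (s : nat -> hom (X n) (X n.+1)) (s' : nat -> hom (X n.+1) (X n.+2)) :
  degen_step s s' -> degen_section s'.
Proof. by move=> st j a jN; rewrite st // degen_faces_eq. Qed.

(** Away from [j], both sides become a single [s] after two faces: [degen_step] moves a face past
    [s'], and the precubical identity compares the faces left over. *)
Lemma degen_step_cubical (C : category) (X : precubical C) n
    (s : nat -> hom (X n) (X n.+1)) (s' : nat -> hom (X n.+1) (X n.+2)) j :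
  degen_step s s' -> 1 <= j <= n.+3 ->
  cubical_identities n.+2 (face X n.+1) (degen_faces s' j).
Proof.
move=> st jN i k w a i1 ik kN.
have [ij|ji|?] := ltngtP i j; last first.
- apply: degen_faces_cubical_mid => //; [exact: degen_step_section st|by left].
- rewrite !degen_faces_gt; try lia.
  rewrite !composeA !st; try lia.
  rewrite !degen_faces_gt; try lia.
  rewrite -!composeA face_face //; lia.
have [kj|jk|?] := ltngtP k j; last first.
- apply: degen_faces_cubical_mid => //; [exact: degen_step_section st|by right].
(* From [i < j < k] follows [i < k.-1], which the precubical identity needs after the shift of
   [k]. *)
- rewrite degen_faces_gt // (degen_faces_lt _ _ ij) !composeA !st; try lia.
  rewrite degen_faces_lt // degen_faces_gt; try lia.
  rewrite -!composeA face_face //; lia.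
- rewrite !degen_faces_lt // !composeA !st; try lia.
  rewrite !degen_faces_lt; try lia.
  rewrite -!composeA face_face //; lia.
Qed.

Lemma exists_pseudodegeneracies (C : category) (X : precubical C) :
  fills_boxes X ->
  (exists u : hom (X 0) (X 1), forall a, face X 0 1 a ∘ u = idm (X 0)) ->
  exists s : forall n, nat -> hom (X n) (X n.+1), pseudodegeneracies s.
Proof.
move=> fill [u0 u0P].
(* Compatibility of the next prescribed faces depends on two consecutive stages; keeping it in the
   invariant lets each stage refer to its predecessor only. *)
pose I n (s : nat -> hom (X n) (X n.+1)) := degen_section s /\
  forall j, 1 <= j <= n.+2 ->
    cubical_identities n.+1 (face X n) (degen_faces s j).
have [||s sP] := @dependent_choice _ I (fun n s s' => degen_step s s').
- have sec : degen_section (X := X) (fun _ => u0).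
    by move=> j a jN; have -> : j = 1 by lia.
  by exists (fun _ => u0); split=> // j; exact: degen_faces_cubical0.
- move=> n s [_ cub].
  (* No identity relates different indices [j] within one dimension, so the boxes are filled
     independently. *)
  have [s' s'P] := choice_on_range (fun j jN => fill _ _ _ (cub j jN)).
  have st : degen_step s s' by move=> i j a iN jN; exact: s'P.
  exists s'; split=> //; split; first exact: degen_step_section st.
  by move=> j; exact: degen_step_cubical st.
have sec n := proj1 (proj1 (sP n)); have st n := proj2 (sP n).
exists s; split=> [n i j a i1 ij jN|n j a j1 jN|n i j a j1 ji iN].
- by rewrite (st n) ?degen_faces_lt //; lia.
- by rewrite sec // j1.
- by rewrite (st n) ?degen_faces_gt //; lia.
Qed.

(** * Pseudoconnections *)

(** The faces required of [Gamma_j] one dimension above [g], where [s] are the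
    pseudodegeneracies in the dimension of [g]. *)
Definition conn_faces (C : category) (X : precubical C) (n : nat)
    (s g : nat -> hom (X n.+1) (X n.+2)) (j i : nat) (a : bool) :
    hom (X n.+2) (X n.+2) :=
  if i < j then g j.-1 ∘ face X n.+1 i a
  else if i <= j.+1 then
    if a then s j ∘ face X n.+1 j true else idm (X n.+2)
  else g j ∘ face X n.+1 i.-1 a.

Lemma conn_faces_lt (C : category) (X : precubical C) n
    (s g : nat -> hom (X n.+1) (X n.+2)) j i a :
  i < j -> conn_faces s g j i a = g j.-1 ∘ face X n.+1 i a.
Proof. by rewrite /conn_faces => ->. Qed.

Lemma conn_faces_mid (C : category) (X : precubical C) n
    (s g : nat -> hom (X n.+1) (X n.+2)) j i a :
  i = j \/ i = j.+1 -> conn_faces s g j i a =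
    if a then s j ∘ face X n.+1 j true else idm (X n.+2).
Proof.
by rewrite /conn_faces; case=> ->; rewrite ?ltnn ?leqnn ?leqnSn // ltnNge leqnSn.
Qed.

Lemma conn_faces_gt (C : category) (X : precubical C) n
    (s g : nat -> hom (X n.+1) (X n.+2)) j i a :
  j.+1 < i -> conn_faces s g j i a = g j ∘ face X n.+1 i.-1 a.
Proof.
by move=> ji; rewrite /conn_faces ltnNge (ltnW (ltnW ji)) /= leqNgt ji.
Qed.

Definition conn_section (C : category) (X : precubical C) (n : nat)
    (s : nat -> hom (X n) (X n.+1)) (g : nat -> hom (X n.+1) (X n.+2)) : Prop :=
  forall i j a, 1 <= j <= n.+1 -> i = j \/ i = j.+1 ->
  face X n.+1 i a ∘ g j =
    if a then s j ∘ face X n j true else idm (X n.+1).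

Definition conn_step (C : category) (X : precubical C) (n : nat)
    (s g : nat -> hom (X n.+1) (X n.+2))
    (g' : nat -> hom (X n.+2) (X n.+3)) : Prop :=
  forall i j a, 1 <= i <= n.+3 -> 1 <= j <= n.+2 ->
  face X n.+2 i a ∘ g' j = conn_faces s g j i a.

Lemma conn_step_section (C : category) (X : precubical C) n
    (s g : nat -> hom (X n.+1) (X n.+2)) (g' : nat -> hom (X n.+2) (X n.+3)) :
  conn_step s g g' -> conn_section s g'.
Proof. by move=> st i j a jN ij; rewrite st ?conn_faces_mid //; lia. Qed.

(** As for [degen_faces_cubical_mid], nothing below [g] is involved. *)
Lemma conn_faces_cubical_mid (C : category) (X : precubical C)
    (s : forall n, nat -> hom (X n) (X n.+1)) n
    (g : nat -> hom (X n.+1) (X n.+2)) j i k w a :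
  pseudodegeneracies s -> conn_section (s n) g ->
  1 <= j <= n.+2 -> 1 <= i -> i < k -> k <= n.+3 ->
  j <= i <= j.+1 \/ j <= k <= j.+1 ->
  face X n.+1 i w ∘ conn_faces (s n.+1) g j k a =
  face X n.+1 k.-1 a ∘ conn_faces (s n.+1) g j i w.
Proof.
move=> [slt seq sgt] sec jN i1 ik kN mid.
have [ij|ji] := ltnP i j.
  (* Here [k] is [j] or [j.+1], so [k.-1] is one of the two middle indices for [g j.-1]. *)
  rewrite (conn_faces_mid _ _ (i := k)); last lia.
  rewrite conn_faces_lt // composeA sec; try lia.
  case: a; last by rewrite compose_idl compose_idr.
  rewrite composeA slt; try lia.
  rewrite -!composeA face_face //; lia.
have [kj|jk] := leqP k j.+1.
  rewrite !conn_faces_mid; try lia.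
  (* Both indices are middle ones; the faces of index [j] then cancel [s n.+1 j]. *)
  have [-> ->] : i = j /\ k = j.+1 by lia.
  case/andP: jN => j1 jN; case: a; case: w => //=.
  - by rewrite composeA seq ?compose_idl ?compose_idr.
  - by rewrite composeA seq ?compose_idl ?compose_idr.
rewrite (conn_faces_mid _ _ (i := i)); last lia.
rewrite conn_faces_gt // composeA sec; try lia.
case: w; last by rewrite compose_idl compose_idr.
rewrite composeA sgt; try lia.
rewrite -!composeA face_face //; lia.
Qed.

Lemma conn_faces_cubical0 (C : category) (X : precubical C)
    (s : forall n, nat -> hom (X n) (X n.+1))
    (g : nat -> hom (X 1) (X 2)) j :
  pseudodegeneracies s -> conn_section (s 0) g -> 1 <= j <= 2 ->
  cubical_identities 2 (face X 1) (conn_faces (s 1) g j).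
Proof.
move=> sP sec jN i k w a i1 ik kN.
by apply: conn_faces_cubical_mid => //; lia.
Qed.

(** The argument for pseudodegeneracies applies, with the pair [j], [j.+1] in place of the single
    index [j]. *)
Lemma conn_step_cubical (C : category) (X : precubical C)
    (s : forall n, nat -> hom (X n) (X n.+1)) n
    (g : nat -> hom (X n.+1) (X n.+2)) (g' : nat -> hom (X n.+2) (X n.+3)) j :
  pseudodegeneracies s -> conn_step (s n.+1) g g' -> 1 <= j <= n.+3 ->
  cubical_identities n.+3 (face X n.+2) (conn_faces (s n.+2) g' j).
Proof.
move=> sP st jN i k w a i1 ik kN.
have sec := conn_step_section st.
have [imid|imid] := boolP (j <= i <= j.+1).
  by apply: conn_faces_cubical_mid => //; left.
have [kmid|kmid] := boolP (j <= k <= j.+1).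
  by apply: conn_faces_cubical_mid => //; right.
have [ij|ji] := ltnP i j; last first.
  rewrite !conn_faces_gt; try lia.
  rewrite !composeA !st; try lia.
  rewrite !conn_faces_gt; try lia.
  rewrite -!composeA face_face //; lia.
have [kj|jk] := ltnP k j.
  rewrite !conn_faces_lt // !composeA !st; try lia.
  rewrite !conn_faces_lt; try lia.
  rewrite -!composeA face_face //; lia.
rewrite conn_faces_gt; last lia.
rewrite (conn_faces_lt _ _ _ ij) !composeA !st; try lia.
rewrite conn_faces_lt // conn_faces_gt; try lia.
rewrite -!composeA face_face //; lia.
Qed.

Lemma exists_pseudoconnections (C : category) (X : precubical C)
    (s : forall n, nat -> hom (X n) (X n.+1)) :
  fills_boxes X -> pseudodegeneracies s ->
  exists g : forall n, nat -> hom (X n.+1) (X n.+2), pseudoconnections s g.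
Proof.
move=> fill sP.
pose I n (g : nat -> hom (X n.+1) (X n.+2)) := conn_section (s n) g /\
  forall j, 1 <= j <= n.+2 ->
    cubical_identities n.+2 (face X n.+1) (conn_faces (s n.+1) g j).
have [||g gP] := @dependent_choice _ I (fun n g g' => conn_step (s n.+1) g g').
(* For the lowest pseudoconnection, [j = 1] and the face indices 1 and 2 are both middle ones, so
   the required faces do not depend on the index. *)
- pose h (_ : nat) a := if a then s 0 1 ∘ face X 0 1 true else idm (X 1).
  have [|u uP] := fill _ _ h.
    move=> i k w a i1 ik kN; have [-> ->] : i = 1 /\ k = 2 by lia.
    by case: a; case: w; rewrite //= !composeA !(face_degen_eq sP) //
      compose_idl compose_idr.
  have sec : conn_section (s 0) (fun _ => u).
    move=> i j a jN ij; rewrite uP; last lia.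
    by have -> : j = 1 by lia.
  by exists (fun _ => u); split=> // j; exact: conn_faces_cubical0.
- move=> n g [_ cub].
  have [g' g'P] := choice_on_range (fun j jN => fill _ _ _ (cub j jN)).
  have st : conn_step (s n.+1) g g' by move=> i j a iN jN; exact: g'P.
  exists g'; split=> //; split; first exact: conn_step_section st.
  by move=> j; exact: (conn_step_cubical sP st).
have sec n := proj1 (proj1 (gP n)); have st n := proj2 (gP n).
exists g.
split=> [n i j a i1 ij jN|n i j j1 jN ij|n i j j1 jN ij|n i j a j1 ji iN].
- by rewrite (st n) ?conn_faces_lt //; lia.
- by rewrite sec // j1.
- by rewrite sec // j1.
- by rewrite (st n) ?conn_faces_gt //; lia.
Qed.

(** * The structure on a resolution *)

Theorem corollary3p5 (C : category) (P : C -> Prop)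
    (hC : has_finite_limits C) (hP : projective_class P)
    (A : C) (X : augmented_precubical A)
    (hX : projective_resolution P X) :
  exists (s : forall n : nat, nat -> hom (X n) (X n.+1))
         (g : forall n : nat, nat -> hom (X n.+1) (X n.+2)),
    pseudodegeneracies s /\ pseudoconnections s g.
Proof.
have fill := resolution_fills_boxes hX.
have [s sP] := exists_pseudodegeneracies fill (resolution_degen0 hX).
have [g gP] := exists_pseudoconnections fill sP.
by exists s, g.
Qed.
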